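(* Let $f,g$ be arithmetic functions, $S_f(t)=\sum_{n\le t}f(n)$ and $S_{f\star g}(t)=\sum_{n\le t}(f\star g)(n)$, where $\star$ is Dirichlet convolution. Let $h:(0,1]\to\mathbb C$ be Lebesgue-integrable on every closed segment contained in $(0,1]$, and let $H$ be a function on $[1,\infty)$ that is absolutely continuous on every finite interval of $[1,\infty)$. Then for every $X\ge1$, \[ \sum_{n\le X}f(n)H\Bigl(\frac Xn\Bigr)-H(1)S_f(X)=\int_1^X S_{f\star g}\Bigl(\frac Xt\Bigr)h\Bigl(\frac1t\Bigr)\frac{dt}{t}+\int_1^X S_f\Bigl(\frac Xt\Bigr)\Bigl(H'(t)-\frac1t\sum_{n\le t}g(n)h\Bigl(\frac nt\Bigr)\Bigr)dt. \] *)

(* Defs.v *)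
From HB Require Import structures.
From mathcomp Require Import all_boot all_order all_algebra.
From mathcomp Require Import complex.
From mathcomp Require Import all_classical all_reals all_analysis.

Set Implicit Arguments.
Unset Strict Implicit.
Unset Printing Implicit Defensive.

Import Order.TTheory GRing.Theory Num.Theory.
Import numFieldNormedType.Exports.

Local Open Scope classical_set_scope.
Local Open Scope ring_scope.
Local Open Scope complex_scope.

(* An arithmetic function is a total [f : nat -> A]; its value at 0 is never
   used, neither in a convolution at n > 0 nor in a summatory function. *)
Definition dirichlet_conv (A : pzSemiRingType) (f g : nat -> A) (n : nat) : A :=
  \sum_(d <- divisors n) f d * g (n %/ d)%N.

Notation "f ⋆ g" := (dirichlet_conv f g)
  (at level 40, left associativity) : ring_scope.

(* For t >= 0, the integers n with 1 <= n <= t are those with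
   1 <= n < (Num.truncn t).+1. *)
Definition summatory (R : realType) (f : nat -> R[i]) (t : R) : R[i] :=
  \sum_(1 <= n < (Num.truncn t).+1) f n.

(* Lebesgue (not merely Borel) measurability is meant, hence the completed
   measure; complex functions are treated through Re and Im. *)
Definition cintegrable (R : realType) (D : set R) (F : R -> R[i]) : Prop :=
  (@completed_lebesgue_measure R).-integrable D (fun t => (complex.Re (F t))%:E) /\
  (@completed_lebesgue_measure R).-integrable D (fun t => (complex.Im (F t))%:E).

Definition cintegral (R : realType) (D : set R) (F : R -> R[i]) : R[i] :=
  (\int[@completed_lebesgue_measure R]_(t in D) complex.Re (F t))
    +i* (\int[@completed_lebesgue_measure R]_(t in D) complex.Im (F t)).

(* Componentwise derivative; where F is not differentiable it is a junk value,
   which for an absolutely continuous F only happens on a null set. *)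
Definition cderive (R : realType) (F : R -> R[i]) (t : R) : R[i] :=
  derive1 (fun x => complex.Re (F x)) t +i* derive1 (fun x => complex.Im (F x)) t.

Definition abs_continuous (R : realType) (a b : R) (F : R -> R[i]) : Prop :=
  forall e : R, 0 < e -> exists2 d : R, 0 < d &
    forall (n : nat) (u v : 'I_n -> R),
      (forall i, a <= u i /\ u i <= v i /\ v i <= b) ->
      trivIset setT (fun i => [set` `]u i, v i[]) ->
      \sum_(i < n) (v i - u i) < d ->
      \sum_(i < n) `|F (v i) - F (u i)| < e%:C.

(* Main.v *)
(* Put k(t) = h(1/t)/t and K(Y) = int_1^Y k, which vanishes for Y < 1.  For F
   integrable on [1, X], writing S_f(X/t) as the sum of the f(m) with t <= X/m
   turns int_1^X S_f(X/t) F(t) dt into sum_m f(m) int_1^(X/m) F.  With F = H'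
   this gives the left-hand side of the theorem; the two terms with h give
   sum_j (f * g)(j) K(X/j) and sum_(m, n) f(m) g(n) K(X/(mn)), the latter after
   the substitution t -> nt, and these agree.

   The analytic inputs are the fundamental theorem of calculus for absolutely
   continuous functions (the variation of H is absolutely continuous, so its
   Lebesgue-Stieltjes measure has a density, and Lebesgue differentiation
   identifies the density with the derivative), and substitutions for functions
   which are only Lebesgue measurable: a Borel map whose preimages of intervals
   have length at most L times that of the interval satisfies the same bound
   for the outer measure of all sets, hence respects completed measurability. *)
From HB Require Import structures.
Require Import Defs.
From mathcomp Require Import all_boot all_order all_algebra.
From mathcomp Require Import complex lra ring.
From mathcomp Require Import all_classical all_reals all_analysis.
From mathcomp Require Import measurable_realfun.

Set Implicit Arguments.
Unset Strict Implicit.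
Unset Printing Implicit Defensive.

Import Order.TTheory GRing.Theory Num.Theory.
Import numFieldNormedType.Exports.

Local Open Scope classical_set_scope.
Local Open Scope ring_scope.
Local Open Scope complex_scope.

(** * Absolute continuity and total variation *)

Section AbsoluteContinuity.
Context {R : realType}.
Implicit Types (a b : R) (f : R -> R) (s t : seq (R * R)).

(** The list need not be sorted, whence the symmetric condition; segments may share end points. *)
Definition nonoverlapping : seq (R * R) -> bool :=
  pairwise (fun p q => (p.2 <= q.1) || (q.2 <= p.1)).

Definition subsegments a b : pred (seq (R * R)) :=
  all (fun p => [&& a <= p.1, p.1 <= p.2 & p.2 <= b]).

Definition len s : R := \sum_(p <- s) (p.2 - p.1).

Definition osc f s : R := \sum_(p <- s) `|f p.2 - f p.1|.

(** Real-valued form of [abs_continuous]: lists replace indexed families, and the non-strict bound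
    on the oscillation passes to suprema. *)
Definition ac a b f := forall e : R, 0 < e -> exists2 d : R, 0 < d &
  forall s, subsegments a b s -> nonoverlapping s -> len s < d -> osc f s <= e.

Lemma subsegmentsS a b c d s : c <= a -> b <= d ->
  subsegments a b s -> subsegments c d s.
Proof.
move=> ca bd; apply: sub_all => p /and3P[ap -> pb].
by rewrite (le_trans ca)//= (le_trans pb).
Qed.

Lemma nonoverlapping_cat a b c s t : subsegments a b s -> subsegments b c t ->
  nonoverlapping s -> nonoverlapping t -> nonoverlapping (s ++ t).
Proof.
move=> /allP sab /allP tbc ss st; rewrite /nonoverlapping pairwise_cat.
apply/and3P; split => //.
apply/allrelP => p q /sab/and3P[_ _ pb] /tbc/and3P[bq _ _].
by rewrite (le_trans pb bq).
Qed.

(** Turns the partitions that define [total_variation] into lists of consecutive segments, to which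
    [ac] applies. *)
Lemma itv_partition_segments f a b l : itv_partition a b l ->
  let s := zip (a :: l) l in
  [/\ subsegments a b s, nonoverlapping s, len s = b - a & osc f s = variation a b f l].
Proof.
move=> ablp; rewrite (variation_zip f ablp) /=.
have oscE c (u : seq R) :
    osc f (zip (c :: u) u) = \sum_(x <- zip u (c :: u)) `|f x.1 - f x.2|.
  rewrite /osc; elim: u c => [|h u ih] c; first by rewrite !big_nil.
  by rewrite /= !big_cons ih.
rewrite -oscE {oscE}; elim: l a ablp => [|x l ih] a.
  by move=> /itv_partition_nil ->; rewrite /len big_nil subrr.
move=> H; have xb := itv_partition_cons H.
have ax : a < x by case: H => /= /andP[].
have xleb := itv_partition_le xb.
have [s1 s2 s3 _] := ih _ xb; split => //=.
- by rewrite lexx (ltW ax) xleb/=; apply: subsegmentsS s1 => //; exact: ltW.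
- apply: (@nonoverlapping_cat a x b [:: (a, x)] _ _ s1) => //=.
  by rewrite lexx (ltW ax) lexx.
- move: s3; rewrite /len big_cons => ->/=; lra.
Qed.

(** Every partition of [x, y] has total length y - x, so a single [d] serves for all of them and the
    bound survives the supremum. *)
Lemma ac_small a b f : ac a b f -> forall e, 0 < e -> exists2 d, 0 < d &
  forall x y, a <= x -> x <= y -> y <= b -> y - x < d ->
    (total_variation x y f <= e%:E)%E.
Proof.
move=> acf e e0; have [d d0 dP] := acf e e0; exists d => // x y ax xy yb xyd.
apply: ge_ereal_sup => _ [_ [l xyl <-] <-]; rewrite lee_fin.
have [s1 s2 s3 <-] := itv_partition_segments f xyl.
by apply: dP => //; [exact: subsegmentsS s1|rewrite s3].
Qed.

(** Take [d] such that segments shorter than [d] have variation at most 1; finitely many steps of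
    length d/2 cover [a, b]. *)
Lemma ac_bounded_variation a b f : a <= b -> ac a b f -> bounded_variation a b f.
Proof.
move=> ab /ac_small/(_ _ ltr01)[d d0 dP].
apply/bounded_variationP => //.
suff H (n : nat) x : a <= x -> x <= b -> x <= a + n%:R * (d / 2) ->
    total_variation a x f \is a fin_num.
  pose n := Num.bound ((b - a) / (d / 2)).
  apply: (H n) => //; rewrite -lerBlDl -ler_pdivrMr ?divr_gt0//.
  by apply/ltW/archi_boundP; rewrite divr_ge0 ?subr_ge0// ltW ?divr_gt0.
elim: n x => [|n ih] x ax xb xn.
  have -> : x = a by apply: le_anti; rewrite ax andbT; lra.
  by rewrite total_variationxx.
have [xn'|xn'] := leP x (a + n%:R * (d / 2)); first exact: ih.
set y := a + n%:R * (d / 2).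
have ay : a <= y by rewrite /y lerDl mulr_ge0//; lra.
rewrite (@total_variationD _ _ _ y)//; last exact: ltW.
rewrite fin_numD ih//=; last by apply: le_trans xb; exact: ltW.
rewrite ge0_fin_numE; last by apply: total_variation_ge0; exact: ltW.
apply: (@le_lt_trans _ _ 1%:E); last by rewrite ltry.
apply: dP => //; first exact: ltW.
move: xn; rewrite -natr1 /y; lra.
Qed.

(** Each segment of [s] is cut by a partition that attains its total variation up to [e]. The
    inclusion of the segments of [t] in those of [s] is what keeps the new cuts from overlapping in
    the induction. *)
Lemma total_variation_segments a b f (e : R) : bounded_variation a b f -> 0 < e ->
  forall s, subsegments a b s -> nonoverlapping s -> exists t,
    [/\ subsegments a b t, nonoverlapping t, len t = len s,
        forall q, q \in t -> exists2 p, p \in s & p.1 <= q.1 /\ q.2 <= p.2 &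
        \sum_(p <- s) fine (total_variation p.1 p.2 f) <= osc f t + (size s)%:R * e].
Proof.
move=> bvf e0; elim => [|p s ih] sab ss.
  by exists [::]; rewrite /osc !big_nil mul0r addr0.
move: sab => /= /andP[/and3P[ap p12 pb] sab].
move: ss; rewrite /nonoverlapping/= => /andP[/allP ps ss].
have [t [t1 t2 t3 t4 t5]] := ih sab ss.
have pfin : total_variation p.1 p.2 f \is a fin_num.
  apply/(bounded_variationP _ p12).
  apply: (bounded_variationl p12 pb).
  by apply: (bounded_variationr ap _ bvf); exact: le_trans pb.
have := @ub_ereal_sup_adherent _ _ e e0 pfin.
move=> [_ [_ [l pl <-] <-]]; rewrite -/(total_variation _ _ _).
rewrite -(fineK pfin) -EFinB lte_fin => lP.
have [l1 l2 l3 l4] := itv_partition_segments f pl.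
exists (zip (p.1 :: l) l ++ t); split.
- by rewrite /subsegments all_cat [all _ t]t1 andbT; exact: subsegmentsS l1.
- rewrite /nonoverlapping pairwise_cat; apply/and3P; split => //.
  apply/allrelP => q r ql /t4[p' p's [p'r rp']].
  have /and3P[pq _ qp] := allP l1 _ ql.
  have /orP[h|h] := ps _ p's.
    by rewrite (le_trans qp)//; exact: le_trans p'r.
  by rewrite orbC (le_trans rp')//; exact: le_trans pq.
- by rewrite /len big_cat big_cons/= -/(len _) l3 -/(len t) t3.
- move=> q; rewrite mem_cat => /orP[/(allP l1)/and3P[q1 _ q2]|/t4[p' ? ?]].
    by exists p; rewrite ?mem_head.
  by exists p' => //; rewrite inE; apply/orP; right.
- rewrite big_cons /osc big_cat/= -/(osc f _) -/(osc f t) l4 -natr1 mulrDl mul1r.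
  lra.
Qed.

(** By additivity, the oscillation of the variation function over [s] is the sum of the variations
    of [f] on the segments. A refinement of the same total length nearly attains it, and there
    absolute continuity of [f] applies. *)
Lemma ac_total_variation a b f : a <= b -> ac a b f ->
  ac a b (fun x => fine (total_variation a x f)).
Proof.
move=> ab acf e e0; have bvf := ac_bounded_variation ab acf.
have e20 : 0 < e / 2 by lra.
have [d d0 dP] := acf _ e20; exists d => // s sab ss sd.
(* An error of e/2/(size s + 1) per segment adds up to at most e/2; the successor covers the empty
   list. *)
have n0 : 0 < (size s).+1%:R :> R by rewrite ltr0n.
have [t [t1 t2 t3 _ t5]] :=
  total_variation_segments bvf (divr_gt0 e20 n0) sab ss.
have -> : osc (fun x => fine (total_variation a x f)) s =
    \sum_(p <- s) fine (total_variation p.1 p.2 f).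
  rewrite /osc big_seq [RHS]big_seq; apply: eq_bigr => p /(allP sab)/and3P[ap p12 pb].
  have p2b : a <= p.2 by exact: le_trans p12.
  have pfin : total_variation p.1 p.2 f \is a fin_num.
    apply/(bounded_variationP _ p12).
    apply: (bounded_variationl p12 pb).
    by apply: (bounded_variationr ap _ bvf); exact: le_trans pb.
  have afin : total_variation a p.1 f \is a fin_num.
    apply/(bounded_variationP _ ap).
    by apply: (bounded_variationl ap _ bvf); exact: le_trans pb.
  rewrite (total_variationD _ ap p12) fineD// addrAC subrr add0r ger0_norm//.
  by rewrite fine_ge0// total_variation_ge0.
apply: (le_trans t5); have := dP t t1 t2; rewrite t3 => /(_ sd) h.
rewrite [leRHS]splitr lerD// mulrC -mulrA ger_pMr// ler_pdivrMl// mulr1.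
by rewrite ler_nat.
Qed.

Lemma acB a b f g : ac a b f -> ac a b g -> ac a b (f \- g).
Proof.
move=> acf acg e e0; have e20 : 0 < e / 2 by lra.
have [d d0 dP] := acf _ e20; have [d' d'0 d'P] := acg _ e20.
exists (Order.min d d'); first by rewrite lt_min d0.
move=> s s1 s2; rewrite lt_min => /andP[sd sd'].
rewrite (splitr e); apply: le_trans (lerD (dP _ s1 s2 sd) (d'P _ s1 s2 sd')).
rewrite /osc -big_split/=; apply: ler_sum => p _.
have -> : (f \- g) p.2 - (f \- g) p.1 = (f p.2 - f p.1) - (g p.2 - g p.1).
  by rewrite /=; ring.
exact: ler_normB.
Qed.

Lemma total_variation_homo a b f : bounded_variation a b f ->
  {in `[a, b] &, nondecreasing_fun (fun x => fine (total_variation a x f))}.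
Proof.
move=> bvf x y xab yab xy; apply: fine_le.
- by move: xab; rewrite in_itv/= => /andP[ax xb]; apply/(bounded_variationP _ ax);
    exact: (bounded_variationl ax xb).
- by move: yab; rewrite in_itv/= => /andP[ax xb]; apply/(bounded_variationP _ ax);
    exact: (bounded_variationl ax xb).
- exact: total_variation_nondecreasing xab yab xy.
Qed.

(** Second half of the Jordan decomposition: an increment of [f] is at most the variation over the
    same segment. *)
Lemma total_variationB_homo a b f : bounded_variation a b f ->
  {in `[a, b] &, nondecreasing_fun (fun x => fine (total_variation a x f) - f x)}.
Proof.
move=> bvf x y; rewrite !in_itv/= => /andP[ax xb] /andP[ay yb] xy.
have xfin : total_variation a x f \is a fin_num.
  by apply/(bounded_variationP _ ax); exact: (bounded_variationl ax xb).
have yfin : total_variation x y f \is a fin_num.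
  apply/(bounded_variationP _ xy); apply: (bounded_variationl xy yb).
  exact: (bounded_variationr ax xb).
rewrite (total_variationD _ ax xy) fineD//.
have : `|f y - f x| <= fine (total_variation x y f).
  by rewrite -lee_fin fineK//; exact: total_variation_ge.
move=> /(le_trans (ler_norm _)); lra.
Qed.

End AbsoluteContinuity.

(** * The fundamental theorem of calculus for absolutely continuous functions *)

Section LebesgueStieltjes.
Context {R : realType}.
Implicit Types (G : cumulative R R) (s : seq (R * R)).
Local Open Scope ereal_scope.

Notation mu := (@lebesgue_measure R).

Lemma lebesgue_stieltjes_measure_itv G (a b : R) : (a <= b)%R ->
  lebesgue_stieltjes_measure G `]a, b]%classic = (G b - G a)%:E.
Proof.
move=> ab; rewrite /lebesgue_stieltjes_measure /measure_extension.
by rewrite measurable_mu_extE/= ?wlength_itv_bnd//; exact: is_ocitv.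
Qed.

(* The segments do not depend on [G]: taking [G = idfun] gives the Lebesgue
   measure of the union. *)
Lemma bigsetU_ocitv_segments (I : (set (ocitv_type R))^nat) n :
  (forall i, ocitv (I i)) -> exists s,
  [/\ all (fun p => p.1 <= p.2)%R s, nonoverlapping s &
      forall G, lebesgue_stieltjes_measure G (\big[setU/set0]_(i < n) I i) =
                (\sum_(p <- s) (G p.2 - G p.1))%:E].
Proof.
move=> mI; set U := \big[setU/set0]_(i < n) I i.
(* A finite union of half-open intervals lies in the ring of sets they generate, where [decomp]
   splits it into finitely many disjoint half-open intervals. *)
pose rT := SetRing.type (ocitv_type R).
have mU : measurable (U : set rT).
  by apply: bigsetU_measurable => i _; apply: sub_gen_smallest; exact: mI.
pose D : set (set (ocitv_type R)) := @SetRing.decomp _ (ocitv_type R) U.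
have fD : finite_set D := @SetRing.decomp_finite_set _ (ocitv_type R) U.
(* [pr] picks the end points of a nonempty piece; the pair of zeros is a filler elsewhere. *)
have /choice[pr prP] : forall X : set R, exists p : R * R,
    X \in D -> X != set0 -> (p.1 < p.2)%R /\ X = `]p.1, p.2]%classic.
  move=> X; have [XD|XD] := boolP (X \in D); last by exists (0%R, 0%R).
  have /ocitvP[->|[p p12 Xp]] := @SetRing.decomp_measurable _ (ocitv_type R) _ _ mU XD.
    by exists (0%R, 0%R) => _; rewrite eqxx.
  by exists p.
pose DS := [seq X <- finmap.enum_fset (fset_set D) | X != set0].
have DSP X : X \in DS -> [/\ X \in D, ((pr X).1 < (pr X).2)%R &
    X = `](pr X).1, (pr X).2]%classic].
  rewrite mem_filter in_fset_set// => /andP[X0 XD].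
  by have [] := prP X XD X0.
exists (map pr DS); split.
- rewrite all_map; apply/allP => X /DSP[_ /ltW//].
- rewrite /nonoverlapping pairwise_map.
  have : uniq DS by rewrite filter_uniq// finmap.fset_uniq.
  rewrite uniq_pairwise; apply: sub_in_pairwise (allss DS) => X Y.
  move=> /DSP[XD X12 XE] /DSP[YD Y12 YE] /= XY.
  rewrite -(negbK (_ || _)) negb_or -!ltNge; apply/negP => /andP[h1 h2].
  (* Overlapping pieces share the smaller of their right ends, hence coincide by disjointness of the
     decomposition. *)
  have : X = Y.
    apply: (@SetRing.decomp_triv _ (ocitv_type R) U _ _ (set_mem XD) (set_mem YD)).
    move: (pr X) (pr Y) XE YE X12 Y12 h1 h2 => p q -> -> p12 q12 h1 h2.
    exists (Order.min p.2 q.2); split => /=;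
      by rewrite in_itv/= lt_min ge_min lexx ?orbT andbT ?p12 ?q12 ?h1 ?h2.
  by move/eqP; rewrite (negbTE XY).
- move=> G; rewrite big_map big_filter.
  have -> : U = \big[setU/set0]_(X <- finmap.enum_fset (fset_set D)) X.
    rewrite -bigcup_fset -(@SetRing.cover_decomp _ (ocitv_type R) U).
    by rewrite fset_setK.
  rewrite measure_fbigsetU; first last.
  + by rewrite fset_setK//; exact: SetRing.decomp_triv.
  + move=> X; rewrite in_fset_set// => XD; apply: sub_sigma_algebra.
    exact: SetRing.decomp_measurable XD.
  rewrite -sumEFin [RHS]big_mkcond big_seq [RHS]big_seq; apply: eq_bigr => X XD.
  case: ifPn => [X0|/negPn/eqP->]; last by rewrite measure0.
  have [|XD' X12 XE] := DSP X; first by rewrite mem_filter X0.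
  by rewrite -(lebesgue_stieltjes_measure_itv G (ltW X12)) -XE.
Qed.

(** A null set has a cover by half-open intervals of total length below [d]. Each finite partial
    union splits into nonoverlapping segments of total length below [d], so its [G]-measure is at
    most [e]; continuity from below gives the same bound for the whole cover. *)
Lemma lebesgue_stieltjes_dominates G :
  (forall e : R, (0 < e)%R -> exists2 d : R, (0 < d)%R & forall s,
    all (fun p => p.1 <= p.2)%R s -> nonoverlapping s -> (len s < d)%R ->
    (osc G s <= e)%R) ->
  lebesgue_stieltjes_measure G `<< mu.
Proof.
move=> acG; apply/null_content_dominatesP => A mA A0.
apply/eqP; rewrite eq_le measure_ge0 andbT.
apply/lee_addgt0Pr => e e0; rewrite add0e.
have [d d0 dP] := acG e e0.
have A0' : mu_ext (wlength idfun) A \is a fin_num.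
  by rewrite -[mu_ext _ _]/(mu A) A0.
have := @lb_ereal_inf_adherent R _ _ d0 A0'.
rewrite -/(mu_ext (wlength idfun) A) -[mu_ext _ _]/(mu A) A0 add0e.
move=> [_ [F [mF AF] <-] Fd].
have mF' i : measurable (F i : set (measurableTypeR R)).
  by apply: sub_sigma_algebra; exact: mF.
apply: (@le_trans _ _ (lebesgue_stieltjes_measure G (\bigcup_i F i))).
  by apply: le_measure; rewrite ?inE//; exact: bigcup_measurable.
pose U n := \big[setU/set0]_(i < n) F i.
have mU n : measurable (U n : set (measurableTypeR R)).
  by apply: bigsetU_measurable => i _.
have UF : \bigcup_i F i = \bigcup_n U n.
  apply/seteqP; split => x [i _]; last first.
    by rewrite /U -bigcup_mkord => -[j _ Fjx]; exists j.
  by move=> Fix; exists i.+1 => //; rewrite /U -bigcup_mkord; exists i => /=.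
have : lebesgue_stieltjes_measure G \o U @ \oo -->
       lebesgue_stieltjes_measure G (\bigcup_n U n).
  apply: nondecreasing_cvg_mu => //; first exact: bigcup_measurable.
  by move=> m n mn; apply/subsetPset; exact: subset_bigsetU.
rewrite UF => /(cvg_lim (@ereal_hausdorff R)) <-.
apply: lime_le.
  apply: ereal_nondecreasing_is_cvgn => m n mn; apply: le_measure; rewrite ?inE//.
  exact: subset_bigsetU.
apply: nearW => n /=; rewrite /U.
have [s [s1 s2 sP]] := @bigsetU_ocitv_segments F n mF.
rewrite sP lee_fin; apply: le_trans (dP s s1 s2 _).
  by apply: ler_sum => p _; exact: ler_norm.
rewrite -lte_fin -[X in X < _](sP idfun) -[lebesgue_stieltjes_measure _]/mu.
apply: le_lt_trans Fd.
apply: (@le_trans _ _ (\sum_(i < n) mu (F i))).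
  by apply: (@content_subadditive _ _ _ mu _ F n) => //; exact: mU.
have FE i : mu (F i) = wlength idfun (F i).
  rewrite /lebesgue_measure /lebesgue_stieltjes_measure /measure_extension.
  by rewrite measurable_mu_extE.
under eq_bigr do rewrite FE.
rewrite -(big_mkord xpredT (fun i => wlength idfun (F i))).
by apply: nneseries_lim_ge => i _ _; exact: wlength_ge0.
Qed.

End LebesgueStieltjes.

(** * Densities of absolutely continuous functions *)

Section Density.
Context {R : realType}.
Implicit Types (a b x y : R) (V f : R -> R) (s : seq (R * R)).

Notation mu := (@lebesgue_measure R).

(** Composition with this projection onto [a, b] extends a function to the line by its end values,
    as a [cumulative] function must be defined everywhere. *)
Definition clamp a b x := Order.max a (Order.min b x).

Lemma clamp_itv a b x : a <= b -> a <= clamp a b x <= b.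
Proof.
move=> ab; rewrite /clamp.
by case: (leP b x) => ?; case: (leP a b) => ?; case: (leP a x) => ?; lra.
Qed.

Lemma clamp_homo a b : {homo clamp a b : x y / x <= y}.
Proof.
move=> x y xy; rewrite /clamp.
by case: (leP b x) => ?; case: (leP b y) => ?; case: (leP a b) => ?;
  case: (leP a x) => ?; case: (leP a y) => ?; lra.
Qed.

Lemma clampB_le a b x y : a <= b -> x <= y -> clamp a b y - clamp a b x <= y - x.
Proof.
move=> ab xy; rewrite /clamp.
by case: (leP b x) => ?; case: (leP b y) => ?; case: (leP a b) => ?;
  case: (leP a x) => ?; case: (leP a y) => ?; lra.
Qed.

Lemma clamp_id a b x : a <= x -> x <= b -> clamp a b x = x.
Proof.
move=> ax xb; rewrite /clamp.
by case: (leP b x) => ?; case: (leP a b) => ?; case: (leP a x) => ?; lra.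
Qed.

(** Clamping preserves order, hence nonoverlapping, and does not lengthen segments. *)
Lemma ac_clamp a b V : a <= b -> ac a b V ->
  forall e : R, 0 < e -> exists2 d : R, 0 < d & forall s,
    all (fun p => p.1 <= p.2) s -> nonoverlapping s -> len s < d ->
    osc (V \o clamp a b) s <= e.
Proof.
move=> ab acV e e0; have [d d0 dP] := acV e e0; exists d => // s s1 s2 sd.
pose cc (p : R * R) := (clamp a b p.1, clamp a b p.2).
have := dP (map cc s); rewrite /osc big_map; apply.
- rewrite /subsegments all_map; apply: sub_all s1 => p /= p12.
  have /andP[-> _] := clamp_itv p.1 ab; have /andP[_ ->] := clamp_itv p.2 ab.
  by rewrite clamp_homo.
- rewrite /nonoverlapping pairwise_map; apply: sub_pairwise s2 => p q /= /orP[] h.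
    by rewrite clamp_homo.
  by rewrite orbC clamp_homo.
- apply: le_lt_trans sd; rewrite /len big_map big_seq [leRHS]big_seq.
  by apply: ler_sum => p /(allP s1) p12; exact: clampB_le.
Qed.

Lemma ac_clamp_right_continuous a b V : a <= b -> ac a b V ->
  right_continuous (V \o clamp a b).
Proof.
move=> ab acV x; apply/cvgrPdist_le => e e0.
have [d d0 dP] := ac_clamp ab acV e0.
near=> y; rewrite distrC.
have := dP [:: (x, y)]; rewrite /osc /len !big_seq1/=; apply => //.
- by rewrite andbT; near: y; exact: nbhs_right_ge.
- by rewrite ltrBlDl; near: y; apply: nbhs_right_lt; rewrite ltrDl.
Unshelve. all: by end_near. Qed.

(** The Lebesgue-Stieltjes measure of the clamped [V] is dominated by [mu]; [phi] is its
    Radon-Nikodym density on ]a, b]. *)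
Lemma ac_homo_density a b V : a <= b -> ac a b V ->
  {in `[a, b] &, nondecreasing_fun V} ->
  exists2 phi : R -> R, mu.-integrable setT (EFin \o phi) &
    forall x, a <= x -> x <= b -> V x = V a + \int[mu]_(t in `[a, x]) phi t.
Proof.
move=> ab acV ndV.
have ndG : nondecreasing_fun (V \o clamp a b).
  by move=> x y xy /=; apply: ndV; rewrite ?in_itv/= ?clamp_itv// clamp_homo.
pose GC := isCumulative.Build R _ R (V \o clamp a b) ndG
             (ac_clamp_right_continuous ab acV).
pose G : cumulative R R := HB.pack (V \o clamp a b) GC.
have Gdom : lebesgue_stieltjes_measure G `<< mu.
  by apply: lebesgue_stieltjes_dominates; exact: ac_clamp.
have mab : measurable (`]a, b]%classic : set (measurableTypeR R)) by [].
have Gab x : a <= x -> x <= b -> lebesgue_stieltjes_measure G `]a, x] = (V x - V a)%:E.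
  move=> ax xb; rewrite lebesgue_stieltjes_measure_itv//=.
  by rewrite !clamp_id.
(* Restriction to ]a, b] gives a finite measure, to which Radon-Nikodym is applied. *)
have Goo : (lebesgue_stieltjes_measure G `]a, b] < +oo)%E by rewrite Gab ?ltry.
pose nu := mfrestr mab Goo.
have nudom : nu `<< mu.
  apply/null_content_dominatesP => A mA A0.
  move/null_content_dominatesP : Gdom => /(_ _ mA A0) GA0.
  apply/eqP; rewrite eq_le measure_ge0 andbT -GA0.
  apply: le_measure; rewrite ?inE//; exact: measurableI.
have [phi [phi0 phifin intphi phiE]] := radon_nikodym_sigma_finite nudom.
(* [phi] has finite values, so [fine] loses nothing. *)
exists (fine \o phi).
  apply: eq_integrable intphi => // t _ /=.
  by rewrite fineK.
move=> x ax xb; apply/eqP; rewrite addrC -subr_eq; apply/eqP.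
have -> : V x - V a = fine (lebesgue_stieltjes_measure G `]a, x]) by rewrite Gab.
have -> : lebesgue_stieltjes_measure G `]a, x] = (\int[mu]_(t in `]a, x]) phi t)%E.
  rewrite -phiE// /= /mfrestr /mrestr; congr (lebesgue_stieltjes_measure G _).
  apply/seteqP; split => t /=; last by case.
  rewrite !in_itv/= => /andP[at_ tx]; split; rewrite ?at_ ?tx//=.
  exact: le_trans xb.
rewrite integral_itv_obnd_cbnd; last first.
  by apply: measurable_funS (measurable_int _ intphi).
rewrite /Rintegral; congr fine; apply: eq_integral => t _ /=.
by rewrite fineK.
Qed.

(** Jordan decomposition: [f] is the difference of its variation V and V - f, both nondecreasing and
    absolutely continuous. *)
Lemma ac_density a b f : a <= b -> ac a b f ->
  exists2 phi : R -> R, mu.-integrable setT (EFin \o phi) &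
    forall x, a <= x -> x <= b -> f x = f a + \int[mu]_(t in `[a, x]) phi t.
Proof.
move=> ab acf; have bvf := ac_bounded_variation ab acf.
have acV := ac_total_variation ab acf.
have [p ip pE] := ac_homo_density ab acV (total_variation_homo bvf).
have [q iq qE] := ac_homo_density ab (acB acV acf) (total_variationB_homo bvf).
have ipq : mu.-integrable setT (EFin \o (p \- q)).
  have -> : EFin \o (p \- q) = ((EFin \o p) \- (EFin \o q))%E by exact/funext.
  exact: integrableB.
exists (p \- q) => // x ax xb.
rewrite RintegralB//; [|exact: integrableS ip|exact: integrableS iq].
have := pE x ax xb; have := qE x ax xb; rewrite /= => h1 h2.
move: h1; rewrite h2; lra.
Qed.

(** Near an interior point [f] is a constant plus the primitive of [phi], whose derivative is [phi]
    almost everywhere by Lebesgue differentiation. *)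
Lemma ac_ae_derive1 a b f : a <= b -> ac a b f ->
  exists2 phi : R -> R, mu.-integrable setT (EFin \o phi) &
    (forall x, a <= x -> x <= b -> f x = f a + \int[mu]_(t in `[a, x]) phi t) /\
    {ae mu, forall x, `]a, b[%classic x -> derive1 f x = phi x}.
Proof.
move=> ab acf; have [phi iphi phiE] := ac_density ab acf.
exists phi => //; split => //.
have locphi : locally_integrable setT phi.
  by apply: open_integrable_locally => //; exact: openT.
have iy y : mu.-integrable [set` Interval (BLeft a) (BRight y)] (EFin \o phi).
  exact: integrableS iphi.
have := FTC1 iy locphi.
apply: filterS; first exact: (ae_filter_ringOfSetsType mu).
move=> x H /=; rewrite in_itv/= => /andP[ax xb].
have [//|dF <-] := H.
set F := fun y => _.
have fF : {near x, f =1 F \+ cst (f a)}.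
  near=> y; rewrite phiE; first by rewrite /= addrC.
    by apply: ltW; near: y; exact: lt_nbhsr.
  by apply: ltW; near: y; exact: lt_nbhsl.
rewrite !derive1E (near_eq_derive _ fF) deriveD//.
by rewrite derive_cst addr0.
Unshelve. all: by end_near. Qed.

End Density.

(** * Completed Lebesgue measure and changes of variables *)

Section CompletedLebesgue.
Context {R : realType}.
Local Open Scope ereal_scope.

Notation mu := (@lebesgue_measure R).
Notation cmu := (@completed_lebesgue_measure R).
Notation cR := (caratheodory_type (@wlength R idfun)^*%mu).

Lemma caratheodory_borel (A : set R) :
  measurable (A : set (measurableTypeR R)) -> measurable (A : set cR).
Proof. exact: sub_caratheodory. Qed.

Lemma caratheodory_itv (i : interval R) : measurable ([set` i] : set cR).
Proof. by apply: caratheodory_borel; exact: measurable_itv. Qed.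

Lemma caratheodory_decomp (E : set R) : measurable (E : set cR) ->
  exists A M : set R, [/\ measurable (A : set (measurableTypeR R)), cmu M = 0 &
    exists2 N, N `<=` M & E = A `|` N].
Proof.
rewrite -completed_caratheodory_measurable g_sigma_completed_algebra_genE.
move=> -[A mA [N [M [mM M0 NM]] <-]]; exists A, M; split => //.
by exists N.
Qed.

Lemma caratheodory_null (N : set R) : cmu N = 0 -> measurable (N : set cR).
Proof.
move=> N0; apply: le_caratheodory_measurable => X.
rewrite -[leRHS]add0e; apply: leeD.
  by rewrite -N0; apply: le_outer_measure; exact: subIsetr.
by apply: le_outer_measure; exact: subIsetl.
Qed.

(** [cmu] evaluates as the outer measure on every set; the preimage estimates below rely on this. *)
Lemma le_completed (A B : set R) : A `<=` B -> cmu A <= cmu B.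
Proof. exact: (@le_mu_ext _ _ _ (wlength idfun)). Qed.

Lemma completed_lebesgue_measure_itv (a b : R) (x y : bool) : (a <= b)%R ->
  cmu [set` Interval (BSide x a) (BSide y b)] = (b - a)%:E.
Proof.
move=> ab; have -> : cmu [set` Interval (BSide x a) (BSide y b)] =
    mu [set` Interval (BSide x a) (BSide y b)] by [].
rewrite lebesgue_measure_itv/= lte_fin; case: ltP => // ba.
by have -> : a = b; [apply: le_anti; rewrite ab|rewrite subrr].
Qed.

(** Pushing [cmu] forward along this map gives [mu], which transfers integrals of Borel functions
    between the two measures. *)
Lemma borel_measurable_id : measurable_fun setT (id : cR -> measurableTypeR R).
Proof. by move=> _ B mB; rewrite setTI; exact: caratheodory_borel. Qed.

Lemma integrable_completed (D : set R) (f : R -> \bar R) :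
  measurable (D : set (measurableTypeR R)) ->
  mu.-integrable setT f -> cmu.-integrable D f.
Proof.
move=> mD intf; have cD := caratheodory_borel mD.
apply: (integrableS (measurableT : measurable [set: cR])) => //.
have /integrableP[mf foo] := intf.
apply/integrableP; split.
  by move=> _ B mB; rewrite setTI -[X in measurable X]setTI;
    apply: caratheodory_borel; exact: mf.
have mnf := measurableT_comp (@abse_measurable R setT) mf.
rewrite -(@ge0_integral_pushforward _ _ cR (measurableTypeR R) R id
  borel_measurable_id cmu setT _ measurableT mnf (fun y _ => abse_ge0 (f y))).
rewrite (@eq_measure_integral _ _ _ setT mu) //; exact: borel_measurable_id.
Qed.

Lemma integral_completed (D : set R) (f : R -> \bar R) :
  measurable (D : set (measurableTypeR R)) ->
  mu.-integrable setT f -> \int[cmu]_(x in D) f x = \int[mu]_(x in D) f x.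
Proof.
move=> mD intf; have icf := integrable_completed mD intf.
have /integrableP[mf _] := intf.
rewrite -(@integral_pushforward _ _ cR (measurableTypeR R) R id
  borel_measurable_id cmu D f mf icf mD).
rewrite (@eq_measure_integral _ (measurableTypeR R) _ D mu) //; exact: borel_measurable_id.
Qed.

(** Completeness of [cmu] makes [g] measurable. This is applied with [g] a derivative, whose values
    on a null set are arbitrary. *)
Lemma ae_eq_completed_integrable (D : set R) (f g : R -> R) :
  measurable (D : set cR) -> ae_eq cmu D f g ->
  cmu.-integrable D (EFin \o f) ->
  cmu.-integrable D (EFin \o g) /\
  \int[cmu]_(x in D) (g x)%:E = \int[cmu]_(x in D) (f x)%:E.
Proof.
move=> mD fg intf; have /integrableP[mf foo] := intf.
have fgE : ae_eq cmu D (EFin \o f) (EFin \o g).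
  by apply: filterS fg => x /[apply] /= ->.
have mg := ae_measurable_fun completed_lebesgue_measure_is_complete fgE mf.
split; last by apply: ae_eq_integral => //; exact: ae_eq_sym.
apply/integrableP; split; first exact: mg.
have mnf := measurableT_comp (@abse_measurable R setT) mf.
have mng := measurableT_comp (@abse_measurable R setT) mg.
have := @ae_eq_integral _ _ _ cmu D _ _ mD mnf mng (ae_eq_abse fgE).
by move=> /= <-; exact: foo.
Qed.

Lemma ac_derive1 (a b : R) (f : R -> R) : (a <= b)%R -> ac a b f ->
  forall x, (a <= x)%R -> (x <= b)%R ->
  cmu.-integrable `[a, x] (EFin \o derive1 f) /\
  (\int[cmu]_(t in `[a, x]) derive1 f t = f x - f a)%R.
Proof.
move=> ab acf x ax xb; have [phi iphi [phiE aephi]] := ac_ae_derive1 ab acf.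
have mI : measurable (`[a, x]%classic : set (measurableTypeR R)) by exact: measurable_itv.
have ms1 (c : R) : measurable ([set c] : set (measurableTypeR R)).
  exact: measurable_set1.
have ae : ae_eq cmu `[a, x]%classic phi (derive1 f).
  case: aephi => N [mN N0 NP].
  (* The density is identified with the derivative only in the open interval, so the end points join
     the null set. *)
  exists (N `|` ([set a] `|` [set b])); split.
  - by apply: caratheodory_borel; apply: measurableU => //; exact: measurableU.
  - have s0 (c : R) : mu [set c] = 0 by exact: lebesgue_measure_set1.
    have ab0 : mu ([set a] `|` [set b]) = 0.
      exact: (etrans (measureU0 (ms1 a) (ms1 b) (s0 b)) (s0 a)).
    exact: (etrans (measureU0 mN (measurableU _ _ (ms1 a) (ms1 b)) ab0) N0).
  - move=> t /= /not_implyP[]; rewrite in_itv/= => /andP[at_ tx] nE.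
    have [->|ta] := eqVneq t a; first by right; left.
    have [->|tb] := eqVneq t b; first by right; right.
    left; apply: NP => /= H; apply: nE; rewrite H// in_itv/=.
    by rewrite lt_neqAle eq_sym ta at_/= lt_neqAle tb (le_trans tx).
have [ig gE] := ae_eq_completed_integrable (caratheodory_borel mI) ae
  (integrable_completed mI iphi).
split => //; rewrite /Rintegral gE (integral_completed mI iphi).
by rewrite (phiE x ax xb) /Rintegral addrC addKr.
Qed.

End CompletedLebesgue.

(** * Substitution in completed Lebesgue integrals *)

Section ChangeOfVariables.
Context {R : realType}.
Local Open Scope ereal_scope.

Notation mu := (@lebesgue_measure R).
Notation cmu := (@completed_lebesgue_measure R).
Notation cR := (caratheodory_type (@wlength R idfun)^*%mu).

Definition preimage_bound (L : R) (phi : R -> R) := forall a b : R, (a <= b)%R ->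
  cmu (phi @^-1` `]a, b]) <= (L * (b - a))%:E.

(** A cover of [A] by half-open intervals pulls back to a cover of the preimage whose total outer
    measure is at most [L] times the length; take the infimum. *)
Lemma completed_preimage_le (L : R) (phi : R -> R) (A : set R) : (0 < L)%R ->
  preimage_bound L phi -> cmu (phi @^-1` A) <= L%:E * cmu A.
Proof.
move=> L0 Lphi; rewrite -lee_pdivrMl//.
apply: le_ereal_inf_tmp => _ [F [mF AF] <-]; rewrite lee_pdivrMl//.
apply: (@le_trans _ _ (cmu (\bigcup_k (phi @^-1` F k)))).
  by rewrite -preimage_bigcup; apply: le_completed => x /AF.
apply: (le_trans (outer_measure_sigma_subadditive (wlength idfun)^*%mu _)).
rewrite -nneseriesZl//; apply: lee_nneseries => // k _.
have [/= [p1 p2] _ <-] := mF k.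
have [p12|p21] := leP p1 p2.
  by rewrite wlength_itv_bnd//; exact: Lphi.
rewrite set_itv_ge ?bnd_simp -?leNgt ?(ltW p21)//.
by rewrite preimage_set0 wlength0 mule0 outer_measure0.
Qed.

(** A measurable set is a Borel set joined with a subset of a null set; the first pulls back to a
    Borel set, the second to a null set by the bound. *)
Lemma caratheodory_measurable_preimage (L : R) (phi : R -> R) : (0 < L)%R ->
  preimage_bound L phi ->
  @measurable_fun _ _ (measurableTypeR R) (measurableTypeR R) setT phi ->
  @measurable_fun _ _ cR cR setT phi.
Proof.
move=> L0 Lphi mphi _ E /caratheodory_decomp[A [M [mA M0 [N NM ->]]]].
rewrite setTI preimage_setU; apply: measurableU.
  by apply: caratheodory_borel; rewrite -[X in measurable X]setTI; exact: mphi.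
apply: caratheodory_null; apply/eqP; rewrite eq_le outer_measure_ge0 andbT.
apply: (le_trans (completed_preimage_le N L0 Lphi)).
apply: (@le_trans _ _ (L%:E * cmu M)); last by rewrite M0 mule0.
by rewrite lee_pmul2l//; exact: le_completed.
Qed.

(** The image of [cmu] under [phi] is at most [L] times [cmu], so the integral of the absolute value
    stays finite. *)
Lemma integrable_comp (L : R) (phi f : R -> R) (D : set R) : (0 < L)%R ->
  preimage_bound L phi ->
  @measurable_fun _ _ (measurableTypeR R) (measurableTypeR R) setT phi ->
  measurable (D : set cR) ->
  cmu.-integrable D (EFin \o f) ->
  cmu.-integrable (phi @^-1` D) (EFin \o (f \o phi)).
Proof.
move=> L0 Lphi mphi mD intf.
have cphi := caratheodory_measurable_preimage L0 Lphi mphi.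
have mpD : measurable (phi @^-1` D : set cR).
  by rewrite -[X in measurable X]setTI; exact: cphi.
pose g := (EFin \o f) \_ D.
have : cmu.-integrable setT g by rewrite -integrable_mkcond.
move=> /integrableP[mg goo].
rewrite integrable_mkcond//.
have -> : (EFin \o (f \o phi)) \_ (phi @^-1` D) = g \o phi.
  by apply/funext => x; rewrite /g /patch; congr (if _ then _ else _);
      apply/idP/idP; rewrite !inE.
apply/integrableP; split; first exact: (measurableT_comp mg cphi).
have mng := measurableT_comp (@abse_measurable R setT) mg.
have := @ge0_integral_pushforward _ _ cR cR R phi cphi cmu setT _ measurableT mng
  (fun y _ => abse_ge0 (g y)).
rewrite preimage_setT => <-.
pose L' : {nonneg R} := NngNum (ltW L0).
apply: (@le_lt_trans _ _ (\int[mscale L' cmu]_x `|g x|)).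
  apply: (@ge0_le_measure_integral _ cR) => //; last by move=> x; exact: abse_ge0.
  by move=> A _; exact: completed_preimage_le.
rewrite ge0_integral_mscale//.
by rewrite lte_mul_pinfty.
Qed.

(** The map and its inverse satisfy the bound with [c] and 1/c, so the image measure is exactly [c]
    times [cmu]. *)
Lemma integral_scaling (c : R) (f : R -> R) (D : set R) : (0 < c)%R ->
  measurable (D : set cR) -> cmu.-integrable D (EFin \o f) ->
  let phi := fun t : R => (t / c)%R in
  cmu.-integrable (phi @^-1` D) (EFin \o (f \o phi)) /\
  (\int[cmu]_(t in phi @^-1` D) f (t / c) = c * \int[cmu]_(t in D) f t)%R.
Proof.
move=> c0 mD intf phi.
have Lphi : preimage_bound c phi.
  move=> a b ab; apply: (@le_trans _ _ (cmu `](a * c)%R, (b * c)%R])).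
    apply: le_completed => x /=; rewrite /phi !in_itv/=.
    by rewrite ltr_pdivlMr// ler_pdivrMr.
  by rewrite completed_lebesgue_measure_itv ?ler_pM2r// -mulrBl mulrC.
have Lpsi : preimage_bound c^-1 (fun t => t * c)%R.
  move=> a b ab; apply: (@le_trans _ _ (cmu `](a / c)%R, (b / c)%R])).
    apply: le_completed => x /=; rewrite !in_itv/=.
    by rewrite ltr_pdivrMr// ler_pdivlMr.
  by rewrite completed_lebesgue_measure_itv ?ler_pM2r ?invr_gt0// -mulrBl mulrC.
have mphi : @measurable_fun _ _ (measurableTypeR R) (measurableTypeR R) setT phi.
  exact: measurable_funM.
have cphi := caratheodory_measurable_preimage c0 Lphi mphi.
have icomp := integrable_comp c0 Lphi mphi mD intf.
split => //.
have cE (A : set R) : cmu (phi @^-1` A) = c%:E * cmu A.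
  apply/eqP; rewrite eq_le completed_preimage_le//=.
  rewrite -lee_pdivlMl//.
  have := completed_preimage_le (phi @^-1` A) _ Lpsi.
  rewrite invr_gt0 => /(_ c0); congr (_ <= _); congr (cmu _).
  by apply/seteqP; split => x /=; rewrite /phi mulfK// gt_eqF.
(* The pushforward formula is applied to a function measurable on the whole line, hence the
   extension by zero. *)
pose g := f \_ D.
have mg : @measurable_fun _ _ cR _ setT (EFin \o g).
  have : cmu.-integrable setT ((EFin \o f) \_ D) by rewrite -integrable_mkcond.
  by move=> /integrableP[+ _]; rewrite restrict_EFin.
have gE : {in D, EFin \o g =1 EFin \o f}.
  by move=> x xD; rewrite /g /= patchE xD.
have igphi : cmu.-integrable (phi @^-1` D) ((EFin \o g) \o phi).
  apply: eq_integrable icomp.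
    by rewrite -[X in measurable X]setTI; exact: cphi.
  by move=> x; rewrite inE => xD; rewrite /= -[LHS]gE// inE.
have := @integral_pushforward _ _ cR cR R phi cphi cmu D (EFin \o g) mg igphi mD.
pose c' : {nonneg R} := NngNum (ltW c0).
rewrite (@eq_measure_integral _ cR _ D (mscale c' cmu)); last first.
  by move=> A _ _; exact: cE.
have mgD := measurable_funS (measurableT : measurable [set: cR]) (@subsetT _ D) mg.
(* Scaling of the measure is applied to the positive and negative parts; the finite negative part
   makes distributivity legitimate. *)
have -> : \int[mscale c' cmu]_(x in D) (EFin \o g) x =
    c%:E * \int[cmu]_(x in D) (EFin \o g) x.
  rewrite [LHS]integralE [in RHS]integralE muleBr//; last first.
    apply: fin_num_adde_defl; rewrite fin_numN.
    apply: integrable_neg_fin_num => //.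
    by apply: eq_integrable intf => // x xD; rewrite gE.
  congr (_ - _); rewrite ge0_integral_mscale//;
    [exact: measurable_funepos|exact: measurable_funeneg].
move=> E; rewrite /Rintegral.
have -> : \int[cmu]_(t in phi @^-1` D) (f (t / c))%:E = c%:E * \int[cmu]_(t in D) (f t)%:E.
  transitivity (\int[cmu]_(x in phi @^-1` D) ((EFin \o g) \o phi) x).
    by apply: eq_integral => x; rewrite inE => xD; rewrite /= -[LHS]gE// inE.
  rewrite -E; congr (_ * _); apply: eq_integral => x xD.
  exact: gE.
rewrite fineM//; exact: integrable_fin_num.
Qed.

End ChangeOfVariables.

(** * The substitution t -> 1/t *)

Section Inversion.
Context {R : realType}.
Local Open Scope ereal_scope.

Notation cmu := (@completed_lebesgue_measure R).
Notation cR := (caratheodory_type (@wlength R idfun)^*%mu).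

(* Inversion alone does not satisfy [preimage_bound], since it contracts near
   infinity; outside [1, X] it is replaced by the identity. *)
Definition inv_on (X t : R) : R := (if t \in `[1, X] then t^-1 else t)%R.

(** On [1, X], u - v = u v (1/v - 1/u) is at most X^2 (b - a) when both inverses lie in ]a, b].
    Hence [S] lies in an interval of that radius about any of its points, which gives 2 X^2; the
    identity part contributes the 1. *)
Lemma inv_on_preimage_bound (X : R) : (1 <= X)%R ->
  preimage_bound (2 * X ^+ 2 + 1) (inv_on X).
Proof.
move=> X1 a b ab; pose S := [set t | t \in `[1%R, X] /\ t^-1%R \in `]a, b]].
apply: (@le_trans _ _ (cmu (S `|` `]a, b]))).
  apply: le_completed => t /=; rewrite /inv_on; case: ifPn => tX h; [left|right] => //.
apply: (le_trans (outer_measureU2 _ _ _)).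
rewrite mulrDl mul1r EFinD; apply: leeD; last first.
  by rewrite -[leRHS](completed_lebesgue_measure_itv false false ab).
have d0 : (0 <= X ^+ 2 * (b - a))%R by rewrite mulr_ge0 ?sqr_ge0// subr_ge0.
have [->|/set0P[x [xX xab]]] := eqVneq S set0.
  by rewrite outer_measure0 lee_fin -mulrA mulr_ge0.
pose d := (X ^+ 2 * (b - a))%R.
have h2 : (x - d <= x + d)%R by rewrite /d; lra.
apply: (@le_trans _ _ (cmu `[(x - d)%R, (x + d)%R])); last first.
  by rewrite completed_lebesgue_measure_itv// lee_fin /d; lra.
apply: le_completed => y [yX yab] /=.
have key (u v : R) : u \in `[1%R, X] -> v \in `[1%R, X] -> u^-1%R \in `]a, b] ->
    v^-1%R \in `]a, b] -> (u - v <= d)%R.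
  rewrite !in_itv/= => /andP[u1 uX] /andP[v1 vX] /andP[au ub] /andP[av vb].
  have u0 : (0 < u)%R by lra.
  have v0 : (0 < v)%R by lra.
  have -> : (u - v = (u * v) * (v^-1 - u^-1))%R.
    by field; rewrite !gt_eqF.
  apply: (@le_trans _ _ (u * v * (b - a))%R).
    by rewrite ler_pM2l ?mulr_gt0//; lra.
  rewrite /d ler_wpM2r ?subr_ge0// expr2.
  by apply: ler_pM => //; exact: ltW.
have := key _ _ xX yX xab yab; have := key _ _ yX xX yab xab.
by rewrite in_itv/=; lra.
Qed.

Lemma measurable_inv_on (X : R) :
  @measurable_fun _ _ (measurableTypeR R) (measurableTypeR R) setT (inv_on X).
Proof.
apply: measurable_fun_if => //.
- apply: (measurable_fun_bool true) => //; rewrite setTI.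
  rewrite [X in measurable X](_ : _ = `[1%R, X]%classic); first exact: measurable_itv.
  by apply/seteqP; split => t.
- rewrite setTI (_ : _ @^-1` _ = `[1%R, X]%classic); last by apply/seteqP; split => t.
  apply: subspace_continuous_measurable_fun; first exact: measurable_itv.
  apply: continuous_in_subspaceT => t; rewrite inE/= in_itv/= => /andP[t1 _].
  by apply: inv_continuous; rewrite gt_eqF//; exact: lt_le_trans t1.
Qed.

(** On [1, X] the map [inv_on] is inversion and takes values in [1/X, 1]. *)
Lemma integrable_inv (X : R) (f : R -> R) : (1 <= X)%R ->
  cmu.-integrable `[X^-1%R, 1%R] (EFin \o f) ->
  cmu.-integrable `[1%R, X] (EFin \o (fun t => f (1 / t)%R)).
Proof.
move=> X1 intf.
have L0 : (0 < 2 * X ^+ 2 + 1)%R.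
  by rewrite ltr_wpDl// mulr_ge0// sqr_ge0.
have := integrable_comp L0 (inv_on_preimage_bound X1) (measurable_inv_on X)
  (caratheodory_itv _) intf.
have sub : `[1%R, X] `<=` inv_on X @^-1` `[X^-1%R, 1%R].
  move=> t tX /=; rewrite /inv_on ifT//; move: tX => /=.
  rewrite !in_itv/= => /andP[t1 tX].
  have t0 : (0 < t)%R by lra.
  by rewrite lef_pV2 ?posrE ?tX ?invf_le1//; lra.
have mX : measurable (`[1%R, X]%classic : set cR) by exact: caratheodory_itv.
have mp : measurable (inv_on X @^-1` `[X^-1%R, 1%R] : set cR).
  rewrite -[X in measurable X]setTI.
  by apply: (caratheodory_measurable_preimage L0 (inv_on_preimage_bound X1)
    (measurable_inv_on X)) => //; exact: caratheodory_itv.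
move=> /(integrableS mp mX sub).
apply: eq_integrable => // t; rewrite inE => tX /=.
by rewrite /inv_on ifT// div1r.
Qed.

Lemma integrable_bounded_mul (a b : R) (f w : R -> R) :
  @measurable_fun _ _ (measurableTypeR R) (measurableTypeR R) `[a, b] w ->
  (exists M : R, forall t, t \in `[a, b] -> (`|w t| <= M)%R) ->
  cmu.-integrable `[a, b] (EFin \o f) ->
  cmu.-integrable `[a, b] (EFin \o (fun t => f t * w t)%R).
Proof.
move=> mw [M wM] intf.
have mI : measurable (`[a, b]%classic : set cR) by exact: caratheodory_itv.
have cw : @measurable_fun _ _ cR (measurableTypeR R) `[a, b] w.
  move=> _ B mB; apply: caratheodory_borel; apply: mw => //; exact: measurable_itv.
have := @integrableMl _ cR R cmu `[a, b]%classic mI (EFin \o f) w intf cw.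
apply.
exists M; split; first exact: num_real.
move=> y My t /= tab; apply: (le_trans (wM _ tab)); exact: ltW.
Qed.

End Inversion.

(** * Complex-valued integrals *)

Section ComplexIntegral.
Context {R : realType}.

Notation cmu := (@completed_lebesgue_measure R).
Notation cR := (caratheodory_type (@wlength R idfun)^*%mu).
Implicit Types (D : set R) (F G : R -> R[i]) (c : R[i]).

Lemma ReD (x y : R[i]) : complex.Re (x + y) = complex.Re x + complex.Re y.
Proof. by case: x; case: y. Qed.

Lemma ImD (x y : R[i]) : complex.Im (x + y) = complex.Im x + complex.Im y.
Proof. by case: x; case: y. Qed.

Lemma ReM (x y : R[i]) : complex.Re (x * y) =
  complex.Re x * complex.Re y - complex.Im x * complex.Im y.
Proof. by case: x; case: y. Qed.

Lemma ImM (x y : R[i]) : complex.Im (x * y) =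
  complex.Re x * complex.Im y + complex.Im x * complex.Re y.
Proof. by case: x; case: y. Qed.

Lemma eq_cintegrable D F G : measurable (D : set cR) ->
  (forall t, D t -> F t = G t) -> cintegrable D F -> cintegrable D G.
Proof.
move=> mD FG [iR iI]; split; [apply: eq_integrable iR|apply: eq_integrable iI] => //;
  by move=> t; rewrite inE => /FG ->.
Qed.

Lemma eq_cintegral D F G : (forall t, D t -> F t = G t) ->
  cintegral D F = cintegral D G.
Proof.
move=> FG; rewrite /cintegral.
by congr (_ +i* _); apply: eq_Rintegral => t; rewrite inE => /FG ->.
Qed.

Lemma cintegralD D F G : measurable (D : set cR) ->
  cintegrable D F -> cintegrable D G ->
  cintegrable D (fun t => F t + G t) /\
  cintegral D (fun t => F t + G t) = cintegral D F + cintegral D G.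
Proof.
move=> mD [FR FI] [GR GI]; split; first split.
- apply: (@eq_integrable _ cR R cmu D mD
    ((EFin \o (fun t => complex.Re (F t))) \+
     (EFin \o (fun t => complex.Re (G t))))%E) => //.
    by move=> t _; rewrite /= ReD EFinD.
  exact: integrableD.
- apply: (@eq_integrable _ cR R cmu D mD
    ((EFin \o (fun t => complex.Im (F t))) \+
     (EFin \o (fun t => complex.Im (G t))))%E) => //.
    by move=> t _; rewrite /= ImD EFinD.
  exact: integrableD.
- rewrite /cintegral; under eq_Rintegral do rewrite ReD.
  under [X in _ +i* X]eq_Rintegral do rewrite ImD.
  by rewrite !RintegralD.
Qed.

Lemma cintegralZ D F c : measurable (D : set cR) -> cintegrable D F ->
  cintegrable D (fun t => c * F t) /\
  cintegral D (fun t => c * F t) = c * cintegral D F.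
Proof.
move=> mD [FR FI].
have iZ (x : R) (u : R -> R) : cmu.-integrable D (EFin \o u) ->
    cmu.-integrable D (EFin \o (fun t => x * u t)).
  move=> iu.
  apply: (@eq_integrable _ cR R cmu D mD (fun t => x%:E * (EFin \o u) t)%E) => //.
  exact: integrableZl.
have iB (u v : R -> R) : cmu.-integrable D (EFin \o u) -> cmu.-integrable D (EFin \o v) ->
    cmu.-integrable D (EFin \o (fun t => u t - v t)).
  move=> iu iv.
  apply: (@eq_integrable _ cR R cmu D mD ((EFin \o u) \- (EFin \o v))%E) => //.
  exact: integrableB.
have iD (u v : R -> R) : cmu.-integrable D (EFin \o u) -> cmu.-integrable D (EFin \o v) ->
    cmu.-integrable D (EFin \o (fun t => u t + v t)).
  move=> iu iv.
  apply: (@eq_integrable _ cR R cmu D mD ((EFin \o u) \+ (EFin \o v))%E) => //.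
  exact: integrableD.
split; first split.
- apply: (@eq_integrable _ cR R cmu D mD (EFin \o (fun t => complex.Re c * complex.Re (F t)
    - complex.Im c * complex.Im (F t)))) => //.
    by move=> t _; rewrite /= ReM.
  by apply: iB; exact: iZ.
- apply: (@eq_integrable _ cR R cmu D mD (EFin \o (fun t => complex.Re c * complex.Im (F t)
    + complex.Im c * complex.Re (F t)))) => //.
    by move=> t _; rewrite /= ImM.
  by apply: iD; exact: iZ.
- rewrite /cintegral; under eq_Rintegral do rewrite ReM.
  under [X in _ +i* X]eq_Rintegral do rewrite ImM.
  rewrite RintegralB ?RintegralD//; try exact: iZ.
  rewrite !RintegralZl//.
  by apply/eqP; rewrite eq_complex ReM ImM /= !eqxx.
Qed.

Lemma cintegral_sum D (I : Type) (s : seq I) (P : pred I) (F : I -> R -> R[i]) :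
  measurable (D : set cR) -> (forall i, P i -> cintegrable D (F i)) ->
  cintegrable D (fun t => \sum_(i <- s | P i) F i t) /\
  cintegral D (fun t => \sum_(i <- s | P i) F i t) =
  \sum_(i <- s | P i) cintegral D (F i).
Proof.
move=> mD iF; elim: s => [|i s [ih1 ih2]].
  split; first split.
  - apply: (@eq_integrable _ cR R cmu D mD (cst 0%E)) => //; last exact: integrable0.
    by move=> t _; rewrite big_nil.
  - apply: (@eq_integrable _ cR R cmu D mD (cst 0%E)) => //; last exact: integrable0.
    by move=> t _; rewrite big_nil.
  - rewrite big_nil /cintegral; under eq_Rintegral do rewrite big_nil/=.
    under [X in _ +i* X]eq_Rintegral do rewrite big_nil/=.
    by rewrite /Rintegral integral0.
rewrite big_cons; case: ifPn => Pi; last first.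
  split; first by apply: eq_cintegrable ih1 => // t _; rewrite big_cons (negbTE Pi).
  by rewrite -ih2; apply: eq_cintegral => t _; rewrite big_cons (negbTE Pi).
have [h1 h2] := cintegralD mD (iF i Pi) ih1.
split; first by apply: eq_cintegrable h1 => // t _; rewrite big_cons Pi.
by rewrite -ih2 -h2; apply: eq_cintegral => t _; rewrite big_cons Pi.
Qed.

(** Brings integrals over varying subintervals to one common domain, where they can be summed. *)
Lemma cintegral_restrict D E F : measurable (D : set cR) -> measurable (E : set cR) ->
  E `<=` D -> cintegrable E F ->
  cintegrable D (fun t => if t \in E then F t else 0) /\
  cintegral D (fun t => if t \in E then F t else 0) = cintegral E F.
Proof.
move=> mD mE ED [FR FI].
have H (u : R -> R) : cmu.-integrable E (EFin \o u) ->
    cmu.-integrable D (EFin \o (u \_ E)).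
  move=> iu; rewrite integrable_mkcond//.
  have -> : (EFin \o (u \_ E)) \_ D = (EFin \o u) \_ E.
    apply/funext => t; rewrite /patch/=; case: ifPn; case: ifPn => //.
    by rewrite !inE notin_setE => /ED.
  by rewrite -integrable_mkcond.
have ReP t : complex.Re (if t \in E then F t else 0) = ((fun t => complex.Re (F t)) \_ E) t.
  by rewrite /patch; case: ifPn.
have ImP t : complex.Im (if t \in E then F t else 0) = ((fun t => complex.Im (F t)) \_ E) t.
  by rewrite /patch; case: ifPn.
split; first split.
- by apply: eq_integrable (H _ FR) => // t _; rewrite /= ReP.
- by apply: eq_integrable (H _ FI) => // t _; rewrite /= ImP.
- rewrite /cintegral; under eq_Rintegral do rewrite ReP.
  under [X in _ +i* X]eq_Rintegral do rewrite ImP.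
  by rewrite -!Rintegral_mkcondr setIidr.
Qed.

Lemma cintegral_scaling (x : R) D F : 0 < x -> measurable (D : set cR) ->
  cintegrable D F ->
  let phi := fun t : R => t / x in
  cintegrable (phi @^-1` D) (fun t => F (t / x)) /\
  cintegral (phi @^-1` D) (fun t => F (t / x)) = x%:C * cintegral D F.
Proof.
move=> x0 mD [FR FI] phi.
have [R1 R2] := integral_scaling x0 mD FR.
have [I1 I2] := integral_scaling x0 mD FI.
split => //.
rewrite /cintegral R2 I2; apply/eqP; rewrite eq_complex ReM ImM /= !mul0r.
by rewrite subr0 addr0 !eqxx.
Qed.

Lemma real_complex_sum (I : Type) (s : seq I) (u : I -> R) :
  (\sum_(i <- s) u i)%:C = \sum_(i <- s) (u i)%:C.
Proof. exact: (big_morph (real_complex R) (fun x y => rmorphD _ x y) (rmorph0 _)). Qed.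

(** Serves for [p] the real or the imaginary part. *)
Lemma abs_continuous_ac (a b : R) F (p : R[i] -> R) :
  (forall x y, p (x - y) = p x - p y) ->
  (forall x, `|p x|%:C <= `|x|) ->
  abs_continuous a b F -> ac a b (p \o F).
Proof.
move=> pB pn acF e e0; have [d d0 dP] := acF e e0; exists d => // s s1 s2 sd.
pose u (i : 'I_(size s)) := (nth (a, a) s i).1.
pose v (i : 'I_(size s)) := (nth (a, a) s i).2.
have lenE : len s = \sum_(i < size s) (v i - u i).
  by rewrite /len (big_nth (a, a)) big_mkord.
have oscE : osc (p \o F) s = \sum_(i < size s) `|p (F (v i)) - p (F (u i))|.
  by rewrite /osc (big_nth (a, a)) big_mkord.
rewrite oscE -lecR.
apply: le_trans (ltW (dP (size s) u v _ _ _)).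
- rewrite real_complex_sum; apply: ler_sum => i _.
  by rewrite -pB; exact: pn.
- by move=> i; have /and3P[] := allP s1 _ (mem_nth (a, a) (ltn_ord i)).
- apply/trivIsetP => i j _ _ ij; rewrite -subset0 => t /= [].
  rewrite !in_itv/= => /andP[ut tv] /andP[ut' tv'].
  wlog : i j ij ut tv ut' tv' / (i < j)%N.
    move=> W; move: ij; rewrite neq_ltn => /orP[ij|ij].
      by apply: (W i j) => //; rewrite neq_ltn ij.
    by apply: (W j i) => //; rewrite neq_ltn ij.
  move=> ltij.
  move/pairwiseP: s2 => /(_ (a, a) i j); rewrite !inE => /(_ (ltn_ord i) (ltn_ord j) ltij) /orP[h|h].
    by move: (lt_trans (lt_le_trans tv h) ut'); rewrite ltxx.
  by move: (lt_trans (lt_le_trans tv' h) ut); rewrite ltxx.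
- by rewrite -lenE.
Qed.

Lemma cintegral_cderive (a b : R) (H : R -> R[i]) : a <= b ->
  abs_continuous a b H -> forall x, a <= x -> x <= b ->
  cintegrable `[a, x] (cderive H) /\ cintegral `[a, x] (cderive H) = H x - H a.
Proof.
move=> ab acH x ax xb.
have acR : ac a b (fun t => complex.Re (H t)).
  apply: (abs_continuous_ac (p := @complex.Re R)) acH.
    by case=> ? ?; case.
  exact: normc_ge_Re.
have acI : ac a b (fun t => complex.Im (H t)).
  apply: (abs_continuous_ac (p := @complex.Im R)) acH.
    by case=> ? ?; case.
  move=> z; rewrite normc_def lecR -sqrtr_sqr ler_wsqrtr// lerDr.
  exact: sqr_ge0.
have [iR eR] := ac_derive1 ab acR ax xb; have [iI eI] := ac_derive1 ab acI ax xb.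
split => //; rewrite /cintegral /= eR eI.
by case: (H x); case: (H a).
Qed.

Lemma cintegrable_inv_weight (h : R -> R[i]) (X : R) : 1 <= X ->
  cintegrable `[X^-1, 1] h ->
  cintegrable `[1, X] (fun t => h (1 / t) * (1 / t)%:C).
Proof.
move=> X1 [hR hI].
have mw : @measurable_fun _ _ (measurableTypeR R) (measurableTypeR R) `[1, X] (fun t => 1 / t).
  apply: subspace_continuous_measurable_fun; first exact: measurable_itv.
  apply: continuous_in_subspaceT => t; rewrite inE/= in_itv/= => /andP[t1 _].
  apply: cvgM; first exact: cvg_cst.
  by apply: inv_continuous; rewrite gt_eqF//; exact: lt_le_trans t1.
have bw : exists M : R, forall t, t \in `[1, X] -> `|1 / t| <= M.
  exists 1 => t; rewrite in_itv/= => /andP[t1 _].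
  by rewrite div1r normfV invf_le1 ger0_norm ?(lt_le_trans _ t1)// (le_trans _ t1).
have mI : measurable (`[1, X]%classic : set cR) by exact: caratheodory_itv.
split.
- apply: eq_integrable (integrable_bounded_mul mw bw (integrable_inv X1 hR)) => // t _.
  by rewrite /= ReM /= mulr0 subr0.
- apply: eq_integrable (integrable_bounded_mul mw bw (integrable_inv X1 hI)) => // t _.
  by rewrite /= ImM /= mulr0 add0r.
Qed.

End ComplexIntegral.

(** * Summation over divisors *)

Section DirichletSum.
Context {A : comNzRingType}.
Implicit Types (f g K : nat -> A).

(** Reindexing by n -> m n; the range n <= N suffices since n <= m n. *)
Lemma big_multiples (F : nat -> A) (m N : nat) : (0 < m)%N ->
  \sum_(1 <= j < N.+1 | (m %| j)%N) F j =
  \sum_(1 <= n < N.+1 | (m * n <= N)%N) F (m * n)%N.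
Proof.
move=> m0; rewrite -big_filter -[RHS]big_filter -(big_map (muln m) xpredT F).
apply: perm_big; apply: uniq_perm.
- by rewrite filter_uniq// iota_uniq.
- rewrite map_inj_uniq ?filter_uniq ?iota_uniq// => x y /eqP.
  by rewrite eqn_pmul2l// => /eqP.
- move=> j; rewrite mem_filter mem_index_iota; apply/idP/mapP.
    move=> /and3P[/dvdnP[n ->]]; rewrite muln_gt0 ltnS => /andP[n0 _] nN.
    exists n; last by rewrite mulnC.
    rewrite mem_filter mem_index_iota mulnC nN n0 ltnS/=.
    by apply: leq_trans nN; rewrite leq_pmulr.
  move=> [n]; rewrite mem_filter mem_index_iota => /and3P[mnN n0 _] ->.
  by rewrite dvdn_mulr// muln_gt0 m0 n0 ltnS.
Qed.

(** Gives all divisor sums the same range, so that the sums over j and d can be exchanged. *)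
Lemma big_divisors (F : nat -> A) (j N : nat) : (0 < j)%N -> (j <= N)%N ->
  \sum_(d <- divisors j) F d = \sum_(1 <= d < N.+1 | (d %| j)%N) F d.
Proof.
move=> j0 jN; rewrite -[RHS]big_filter; apply: perm_big; apply: uniq_perm.
- exact: divisors_uniq.
- by rewrite filter_uniq// iota_uniq.
- move=> d; rewrite -dvdn_divisors// mem_filter mem_index_iota ltnS.
  have [dj|//] := boolP (d %| j)%N.
  by rewrite (dvdn_gt0 j0 dj) (leq_trans (dvdn_leq j0 dj)).
Qed.

(** Write j = m n. The vanishing of [K] beyond [N] extends the region m n <= N to the full
    square. *)
Lemma dirichlet_conv_sum f g K (N : nat) : (forall j, (N < j)%N -> K j = 0) ->
  \sum_(1 <= j < N.+1) (f ⋆ g) j * K j =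
  \sum_(1 <= m < N.+1) \sum_(1 <= n < N.+1) f m * g n * K (m * n)%N.
Proof.
move=> K0.
transitivity (\sum_(1 <= j < N.+1) \sum_(1 <= m < N.+1 | (m %| j)%N)
    f m * g (j %/ m)%N * K j).
  rewrite big_nat [RHS]big_nat; apply: eq_bigr => j /andP[j0 jN].
  by rewrite /dirichlet_conv (big_divisors _ j0 jN) mulr_suml.
rewrite (exchange_big_dep xpredT)//= big_nat [RHS]big_nat.
apply: eq_bigr => m /andP[m0 _].
rewrite (big_multiples (fun j => f m * g (j %/ m)%N * K j) N m0).
rewrite big_mkcond; apply: eq_bigr => n _.
case: ifPn => [_|]; first by rewrite mulKn.
by rewrite -ltnNge => /K0 ->; rewrite mulr0.
Qed.

End DirichletSum.

(** * Summatory functions under the integral sign *)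

Section HyperbolaIdentity.
Context {R : realType}.
Notation cR := (caratheodory_type (@wlength R idfun)^*%mu).
Implicit Types (f g : nat -> R[i]) (h H F : R -> R[i]) (X Y t : R).

Let cmu_itv (a b : R) : measurable (`[a, b]%classic : set cR) := caratheodory_itv _.

(** For t >= 1, m <= X/t exactly when t lies in [1, X/m]; the range of [m] no longer depends on
    [t]. *)
Lemma summatory_div f X t : 0 <= X -> 1 <= t ->
  summatory f (X / t) = \sum_(1 <= m < (Num.truncn X).+1)
    f m * (t \in `[1, X / m%:R])%:R.
Proof.
move=> X0 t1; have t0 : 0 < t by exact: lt_le_trans t1.
have Xt0 : 0 <= X / t by rewrite divr_ge0// ltW.
have tX : (Num.truncn (X / t) <= Num.truncn X)%N.
  by apply: le_truncn; rewrite ler_pdivrMr// ler_peMr.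
rewrite /summatory [RHS](big_cat_nat _ (n := (Num.truncn (X / t)).+1))//=.
have memE m : (0 < m)%N -> (t \in `[1, X / m%:R]) = (m <= Num.truncn (X / t))%N.
  move=> m0; rewrite in_itv/= t1/= truncn_ge_nat//.
  by rewrite !ler_pdivlMr ?ltr0n// mulrC.
rewrite [X in _ + X]big_nat [X in _ + X]big1 ?addr0; last first.
  move=> m /andP[mt _]; rewrite memE; last exact: leq_trans mt.
  by rewrite leqNgt mt mulr0.
rewrite big_nat [RHS]big_nat; apply: eq_bigr => m /andP[m0 mt].
by rewrite memE// -ltnS mt mulr1.
Qed.

Lemma cintegral_summatory f F X : 0 <= X ->
  (forall m, (0 < m)%N -> (m <= Num.truncn X)%N -> cintegrable `[1, X / m%:R] F) ->
  cintegrable `[1, X] (fun t => summatory f (X / t) * F t) /\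
  cintegral `[1, X] (fun t => summatory f (X / t) * F t) =
  \sum_(1 <= m < (Num.truncn X).+1) f m * cintegral `[1, X / m%:R] F.
Proof.
move=> X0 iF.
pose G m t := f m * (if t \in [set` `[1, X / m%:R]] then F t else 0).
have GP m : (0 < m < (Num.truncn X).+1)%N ->
    cintegrable `[1, X] (G m) /\
    cintegral `[1, X] (G m) = f m * cintegral `[1, X / m%:R] F.
  rewrite ltnS => /andP[m0 mX].
  have sub : [set` `[1, X / m%:R]] `<=` [set` `[1, X]].
    apply: subset_itvl; rewrite bnd_simp ler_pdivrMr ?ltr0n//.
    by rewrite ler_peMr// ler1n.
  have [h1 h2] := cintegral_restrict (cmu_itv _ _) (cmu_itv _ _) sub (iF m m0 mX).
  by rewrite -h2; exact: cintegralZ.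
(* The range is repeated as a predicate, since integrability of [G m] is known only there. *)
have [S1 S2] := @cintegral_sum R `[1, X]%classic nat (index_iota 1 (Num.truncn X).+1)
  (fun m => (0 < m < (Num.truncn X).+1)%N) G (cmu_itv _ _) (fun m hm => (GP m hm).1).
have GE t : `[1, X]%classic t ->
    \sum_(1 <= m < (Num.truncn X).+1 | (0 < m < (Num.truncn X).+1)%N) G m t =
    summatory f (X / t) * F t.
  rewrite /= in_itv/= => /andP[t1 _]; rewrite -big_nat summatory_div// mulr_suml.
  apply: eq_bigr => m _; rewrite /G mem_setE -mulrA; congr (_ * _).
  by case: ifP => _; rewrite ?mul1r ?mul0r.
split; first exact: eq_cintegrable S1.
rewrite -(eq_cintegral GE) S2 [RHS]big_nat; apply: eq_bigr => m hm.
by have [_ ->] := GP m hm.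
Qed.

(** Since h(n/t)/t = k(t/n)/n, the substitution t -> n t cancels the factor 1/n. Terms with n > Y
    integrate over an empty interval, so the sum can run up to [X] whatever [Y] is. *)
Lemma cintegral_tail g h Y X : 1 <= Y -> Y <= X ->
  let k := fun t => h (1 / t) * (1 / t)%:C in
  (forall Z, 1 <= Z -> cintegrable `[1, Z] k) ->
  let P := fun t => (1 / t)%:C *
    \sum_(1 <= n < (Num.truncn t).+1) g n * h (n%:R / t) in
  cintegrable `[1, Y] P /\
  cintegral `[1, Y] P =
  \sum_(1 <= n < (Num.truncn X).+1) g n * cintegral `[1, Y / n%:R] k.
Proof.
move=> Y1 YX k ik P.
have X0 : 0 <= X by lra.
pose N := (Num.truncn X).+1.
pose G n t := (g n * (n%:R^-1)%:C) *
  (if t \in [set` `[n%:R, Y]] then k (t / n%:R) else 0).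
have GP n : (0 < n < N)%N -> cintegrable `[1, Y] (G n) /\
    cintegral `[1, Y] (G n) = g n * cintegral `[1, Y / n%:R] k.
  move=> /andP[n0 nN].
  have n0' : (0 : R) < n%:R by rewrite ltr0n.
  have n1' : (1 : R) <= n%:R by rewrite ler1n.
  have sub : [set` `[n%:R, Y]] `<=` [set` `[1, Y]] by apply: subset_itvr; rewrite bnd_simp.
  have ikn : cintegrable `[1, Y / n%:R] k.
    have [Yn|Yn] := leP 1 (Y / n%:R); first exact: ik.
    by rewrite set_itv_ge ?bnd_simp -?ltNge//; split; exact: integrable_set0.
  have [s1 s2] := cintegral_scaling n0' (cmu_itv _ _) ikn.
  have phiE : (fun t => t / n%:R) @^-1` [set` `[1, Y / n%:R]] = [set` `[n%:R, Y]].
    apply/seteqP; split => t /=; rewrite !in_itv/= ler_pdivlMr// mul1r ler_pM2r ?invr_gt0//.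
  rewrite phiE in s1 s2.
  have [r1 r2] := cintegral_restrict (cmu_itv _ _) (cmu_itv _ _) sub s1.
  have [z1 z2] := cintegralZ (g n * (n%:R^-1)%:C) (cmu_itv _ _) r1.
  split => //; rewrite z2 r2 s2 -mulrA; congr (_ * _).
  by rewrite mulrA -rmorphM/= mulVf ?gt_eqF// mul1r.
have [S1 S2] := @cintegral_sum R `[1, Y]%classic nat (index_iota 1 N)
  (fun m => (0 < m < N)%N) G (cmu_itv _ _) (fun m hm => (GP m hm).1).
have GE t : `[1, Y]%classic t -> \sum_(1 <= n < N | (0 < n < N)%N) G n t = P t.
  rewrite /= in_itv/= => /andP[t1 tY]; rewrite -big_nat /P mulr_sumr.
  have t0 : 0 < t by exact: lt_le_trans t1.
  have tX : (Num.truncn t <= Num.truncn X)%N by apply: le_truncn; exact: le_trans YX.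
  rewrite (big_cat_nat _ (n := (Num.truncn t).+1))//=.
  have memE n : (0 < n)%N -> (t \in [set` `[n%:R, Y]]) = (n <= Num.truncn t)%N.
    by move=> n0; rewrite mem_setE in_itv/= tY andbT truncn_ge_nat// ltW.
  rewrite [X in _ + X]big_nat [X in _ + X]big1 ?addr0; last first.
    move=> n /andP[nt _]; rewrite /G memE; last exact: leq_trans nt.
    by rewrite leqNgt nt mulr0.
  rewrite big_nat [RHS]big_nat; apply: eq_bigr => n /andP[n0 nt].
  rewrite /G memE// -ltnS nt /k.
  have n0' : (n%:R : R) != 0 by rewrite pnatr_eq0 -lt0n.
  have -> : 1 / (t / n%:R) = n%:R / t :> R by rewrite div1r invf_div.
  have -> : (1 / t)%:C = (n%:R^-1)%:C * (n%:R / t)%:C.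
    by rewrite -rmorphM/= mulrA mulVf.
  by ring.
split; first exact: eq_cintegrable S1.
rewrite -(eq_cintegral GE) S2 [RHS]big_nat; apply: eq_bigr => n hn.
by have [_ ->] := GP n hn.
Qed.

End HyperbolaIdentity.

Theorem theorem1p4 (R : realType) (f g : nat -> R[i]) (h H : R -> R[i])
  (h_int : forall a b : R, 0 < a -> a <= b -> b <= 1 -> cintegrable `[a, b] h)
  (H_ac : forall a b : R, 1 <= a -> a <= b -> abs_continuous a b H)
  (X : R) (X_ge1 : 1 <= X) :
  let I1 := fun t : R =>
    summatory (f ⋆ g) (X / t) * h (1 / t) * (1 / t)%:C in
  let I2 := fun t : R =>
    summatory f (X / t) *
      (cderive H t - (1 / t)%:C * \sum_(1 <= n < (Num.truncn t).+1) g n * h (n%:R / t)) in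
  [/\ cintegrable `[1, X] I1,
      cintegrable `[1, X] I2 &
      \sum_(1 <= n < (Num.truncn X).+1) f n * H (X / n%:R) - H 1 * summatory f X =
        cintegral `[1, X] I1 + cintegral `[1, X] I2].

Proof.
move=> I1 I2.
have X0 : 0 <= X by exact: le_trans X_ge1.
have mI (a b : R) : measurable (`[a, b]%classic :
    set (caratheodory_type (@wlength R idfun)^*%mu)) := caratheodory_itv _.
pose k t := h (1 / t) * (1 / t)%:C.
pose K (Y : R) := cintegral `[1, Y] k.
have ik Y : 1 <= Y -> cintegrable `[1, Y] k.
  move=> Y1; apply: cintegrable_inv_weight => //; apply: h_int => //.
    by rewrite invr_gt0 (lt_le_trans _ Y1).
  by rewrite invf_le1// (lt_le_trans _ Y1).
have quot m : (0 < m)%N -> (m <= Num.truncn X)%N -> 1 <= X / m%:R /\ X / m%:R <= X.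
  move=> m0; rewrite truncn_ge_nat// => mX.
  by rewrite ler_pdivlMr ?ltr0n// mul1r; split=> //;
    rewrite ler_pdivrMr ?ltr0n// ler_peMr// ler1n.
have [A1 A2] := @cintegral_summatory R (f ⋆ g) k X X0
  (fun m m0 mX => ik _ (quot m m0 mX).1).
pose P (t : R) := (1 / t)%:C * \sum_(1 <= n < (Num.truncn t).+1) g n * h (n%:R / t).
pose N := (Num.truncn X).+1.
(* The bracket of the second integral. *)
pose F t := cderive H t - P t.
have FP m : (0 < m)%N -> (m <= Num.truncn X)%N ->
    cintegrable `[1, X / m%:R] F /\
    cintegral `[1, X / m%:R] F =
    H (X / m%:R) - H 1 - \sum_(1 <= n < N) g n * K (X / m%:R / n%:R).
  move=> m0 mX; have [Y1 YX] := quot m m0 mX.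
  have [d1 d2] := cintegral_cderive X_ge1 (H_ac _ _ (lexx 1) X_ge1) Y1 YX.
  have [p1 p2] := cintegral_tail g Y1 YX ik.
  have [q1 q2] := cintegralZ (-1) (mI _ _) p1.
  have [r1 r2] := cintegralD (mI _ _) d1 q1.
  have E t : `[1, X / m%:R]%classic t -> cderive H t + -1 * P t = F t.
    by rewrite mulN1r.
  split; first exact: eq_cintegrable r1.
  by rewrite -(eq_cintegral E) r2 d2 q2 p2 mulN1r.
have [B1 B2] := cintegral_summatory f X0 (fun m m0 mX => (FP m m0 mX).1).
have E1 t : `[1, X]%classic t -> summatory (f ⋆ g) (X / t) * k t = I1 t.
  by rewrite /I1 /k mulrA.
split; [exact: eq_cintegrable A1|exact: B1|].
rewrite -(eq_cintegral E1) A2 B2.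
(* For j > X the interval [1, X/j] is empty and [K] vanishes there. *)
rewrite (dirichlet_conv_sum f g (K := fun j => K (X / j%:R))); last first.
  move=> j Nj; rewrite /K set_itv_ge; last first.
    rewrite bnd_simp -ltNge ltr_pdivrMr ?mul1r ?ltr0n; last exact: leq_ltn_trans Nj.
    by rewrite ltNge -truncn_ge_nat// -ltnNge.
  by rewrite /cintegral !Rintegral_set0.
rewrite /summatory mulr_sumr -sumrB -big_split/= big_nat [RHS]big_nat.
apply: eq_bigr => m /andP[m0 mN]; rewrite (FP m m0 mN).2 mulrBr mulr_sumr.
rewrite addrC -addrA (_ : - _ + _ = 0) ?addr0; first by ring.
(* The two sums with [K] cancel term by term, as X/(m n) = (X/m)/n. *)
apply/eqP; rewrite addrC subr_eq0; apply/eqP; apply: eq_bigr => n _.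
by rewrite natrM invfM mulrA mulrA.
Qed.
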